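(* Let $F$ be a real Hilbert space and let the model sets be the hyperellipsoidal sets $$\mathcal{K}_0=\{g\in F:\|P_0g\|\le\varepsilon_0\},\qquad \mathcal{K}_1=\{g\in F:\|P_1g\|\le\varepsilon_1\},$$ where $\varepsilon_0,\varepsilon_1>0$ and $P_0,P_1$ are linear maps from $F$ into Hilbert spaces. Let $\Lambda_0:F\to\mathbb{R}^{m_0}$ and $\Lambda_1:F\to\mathbb{R}^{m_1}$ be linear observation maps. If the linear quantity of interest $Q:F\to Z$ maps into a Hilbert space $Z$, then a globally optimal recovery map is given by $\Delta^{\rm opt}:y=[y_0;y_1]\in\mathbb{R}^{m_0+m_1}\mapsto Q(f_0^{\tau^\sharp})\in Z$, where $$[f_0^{\tau^\sharp};f_1^{\tau^\sharp}]=\underset{[f_0;f_1]\in F\times F}{\rm argmin}\ \left[(1-\tau^\sharp)\|P_0f_0\|^2+\tau^\sharp\|P_1(f_0-f_1)\|^2\right]\quad\text{subject to}\quad \Lambda_0f_0=y_0,\ \Lambda_1f_1=y_1.$$ Here, the regularization parameter is $\tau^\sharp=c_1^\sharp/(c_0^\sharp+c_1^\sharp)$, with $c_0^\sharp,c_1^\sharp\ge0$ being solutions to $$\underset{c_0,c_1\ge0}{\rm minimize}\ [c_0\varepsilon_0^2+c_1\varepsilon_1^2]\quad\text{subject to}\quad c_0\|P_0f_0\|^2+c_1\|P_1(f_0-f_1)\|^2\ge\|Qf_0\|^2\ \text{ for all } f_0\in\ker(\Lambda_0),\ f_1\in\ker(\Lambda_1).$$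
   Context: An unknown $f_0\in F$ and a related $f_1\in F$ satisfy $f_0\in\mathcal{K}_0$, $f_0-f_1\in\mathcal{K}_1$ and are observed through $y_0=\Lambda_0f_0$, $y_1=\Lambda_1f_1$. A recovery map is an arbitrary map $\Delta:\mathbb{R}^{m_0+m_1}\to Z$; its global worst-case error is $${\rm gwce}(\Delta)=\sup\big\{\|Q(f_0)-\Delta([\Lambda_0f_0;\Lambda_1f_1])\|_Z : f_0\in\mathcal{K}_0,\ f_0-f_1\in\mathcal{K}_1\big\}.$$ A recovery map is globally optimal if it minimizes ${\rm gwce}(\Delta)$ over all maps $\Delta:\mathbb{R}^{m_0+m_1}\to Z$. Standing assumptions. All linear maps are bounded. It is assumed that $P_0f_0=0$, $P_1(f_0-f_1)=0$, $\Lambda_0f_0=0$, $\Lambda_1f_1=0$ together imply $f_0=0$ and $f_1=0$; when $\dim F=\infty$, it is assumed instead that there is $\delta>0$ such that $\max\{\tfrac1{\varepsilon_0}\|P_0h_0\|,\tfrac1{\varepsilon_1}\|P_1(h_0-h_1)\|\}\ge\delta\,\|[h_0;h_1]\|$ for all $h_0\in\ker(\Lambda_0)$, $h_1\in\ker(\Lambda_1)$. The only data vectors that matter are those of the form $y=[\Lambda_0f_0;\Lambda_1f_1]$, for which the constraint of the argmin is feasible; values of $\Delta^{\rm opt}$ at other vectors are immaterial. It is understood that $c_0^\sharp+c_1^\sharp>0$, so that $\tau^\sharp$ is defined. *)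

(* Defs.v *)
From HB Require Import structures.
From mathcomp Require Import all_boot all_order all_algebra.
From mathcomp Require Import all_classical all_reals all_analysis.

Set Implicit Arguments.
Unset Strict Implicit.
Unset Printing Implicit Defensive.

Import Order.TTheory GRing.Theory Num.Theory.
Import numFieldNormedType.Exports.

Local Open Scope classical_set_scope.
Local Open Scope ring_scope.

(* A real Hilbert space is a complete normed space whose norm comes from an
   inner product; positive definiteness of [inner] follows from [inner_norm]. *)
HB.mixin Record isHilbert (R : realType) H of CompleteNormedModule R H := {
  inner : H -> H -> R;
  innerC : forall u v, inner u v = inner v u;
  innerP : forall a u v w, inner (a *: u + v) w = a * inner u w + inner v w;
  inner_norm : forall u, inner u u = `|u| ^+ 2
}.

#[short(type="hilbertType")]
HB.structure Definition Hilbert (R : realType) :=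
  {H of CompleteNormedModule R H & isHilbert R H}.

Definition argmin (R : realType) (T : Type) (J : T -> R) (A : set T) : set T :=
  [set x | A x /\ forall y, A y -> J x <= J y].

Definition finite_dimensional (R : realType) (V : lmodType R) : Prop :=
  exists (n : nat) (e : 'I_n -> V),
    forall x, exists c : 'I_n -> R, x = \sum_(i < n) c i *: e i.

Definition hyperellipsoid (R : realType) (F H : normedModType R)
  (P : F -> H) (eps : R) : set F := [set g | `|P g| <= eps].

Section Recovery.
Context (R : realType) (F H0 H1 Z : hilbertType R) (m0 m1 : nat).
Variables (P0 : F -> H0) (P1 : F -> H1).
Variables (L0 : F -> 'cV[R]_m0) (L1 : F -> 'cV[R]_m1) (Q : F -> Z).

(* A pair [f : F * F] stands for [f_0; f_1]. *)
Definition observation (f : F * F) : 'cV[R]_(m0 + m1) :=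
  col_mx (L0 f.1) (L1 f.2).

(* The supremum is taken in the extended reals, since it may be infinite. *)
Definition gwce (K0 K1 : set F) (Delta : 'cV[R]_(m0 + m1) -> Z) : \bar R :=
  ereal_sup [set (`|Q f.1 - Delta (observation f)|)%:E |
             f in [set f : F * F | K0 f.1 /\ K1 (f.1 - f.2)]].

Definition globally_optimal (K0 K1 : set F)
  (Delta : 'cV[R]_(m0 + m1) -> Z) : Prop :=
  forall Delta' : 'cV[R]_(m0 + m1) -> Z,
    (gwce K0 K1 Delta <= gwce K0 K1 Delta')%E.

(* [F * F] carries the max norm in the library, hence the explicit Hilbertian
   norm of the pair [h_0; h_1]. *)
Definition standing_assumption (eps0 eps1 : R) : Prop :=
  (finite_dimensional F ->
     forall f0 f1 : F, P0 f0 = 0 -> P1 (f0 - f1) = 0 -> L0 f0 = 0 -> L1 f1 = 0 ->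
       f0 = 0 /\ f1 = 0) /\
  (~ finite_dimensional F ->
     exists2 delta : R, 0 < delta &
       forall h0 h1 : F, L0 h0 = 0 -> L1 h1 = 0 ->
         Num.max (eps0^-1 * `|P0 h0|) (eps1^-1 * `|P1 (h0 - h1)|)
           >= delta * Num.sqrt (`|h0| ^+ 2 + `|h1| ^+ 2)).

Definition admissible_coefficients : set (R * R) :=
  [set c | [/\ 0 <= c.1, 0 <= c.2 &
     forall f0 f1 : F, L0 f0 = 0 -> L1 f1 = 0 ->
       c.1 * `|P0 f0| ^+ 2 + c.2 * `|P1 (f0 - f1)| ^+ 2 >= `|Q f0| ^+ 2]].

Definition optimal_coefficients (eps0 eps1 : R) : set (R * R) :=
  argmin (fun c => c.1 * eps0 ^+ 2 + c.2 * eps1 ^+ 2) admissible_coefficients.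

Definition regularizers (tau : R) (y : 'cV[R]_(m0 + m1)) : set (F * F) :=
  argmin (fun f => (1 - tau) * `|P0 f.1| ^+ 2 + tau * `|P1 (f.1 - f.2)| ^+ 2)
    [set f | L0 f.1 = usubmx y /\ L1 f.2 = dsubmx y].

End Recovery.

(* Main.v *)
Require Import Defs.
From HB Require Import structures.
From mathcomp Require Import all_boot all_order all_algebra.
From mathcomp Require Import all_classical all_reals all_analysis.
From mathcomp Require Import ring lra.

Set Implicit Arguments.
Unset Strict Implicit.
Unset Printing Implicit Defensive.

Import Order.TTheory GRing.Theory Num.Theory.
Import numFieldNormedType.Exports.

Local Open Scope classical_set_scope.
Local Open Scope ring_scope.

(** Call a pair h = [h_0; h_1] unobserved when L0 h_0 = 0 and L1 h_1 = 0, and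
    write q_0(h) = |P0 h_0|^2, q_1(h) = |P1 (h_0 - h_1)|^2, q(h) = |Q h_0|^2.
    The energy minimized by the regularizers is the quadratic form
    (1 - tau) q_0 + tau q_1, which for tau = c1 / (c0 + c1) equals
    (c0 q_0 + c1 q_1) / (c0 + c1).  The theorem holds because the
    number c0 eps0^2 + c1 eps1^2 separates the squared worst-case error of the
    regularizer from that of every other recovery map.

    Upper bound ([orthogonal_error]).  A minimizer g of the energy among the
    pairs with the same data as f is orthogonal, for the energy form, to all
    unobserved pairs.  Admissibility of (c0, c1) bounds q (f - g) by
    (c0 + c1) times the energy of f - g, which by Pythagoras is at most the
    energy of f, so that q (f - g) <= c0 eps0^2 + c1 eps1^2 for f in the model
    set.  The same two facts show that all minimizers have the same image
    under Q.

    Lower bound ([strong_duality]).  If h is unobserved and in the model set,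
    then so is - h, and both produce the data 0; hence a recovery map of
    worst-case error r forces |Q h_0| <= r.  By homogeneity,
    max (a_0 q_0 - q, a_1 q_1 - q) >= 0 on unobserved pairs, where
    a_i = (r / eps_i)^2.  Yuan's lemma ([nonneg_max_combination]) turns a
    nonnegative maximum of two quadratic forms into a nonnegative convex
    combination with a weight m, which says that (m a_0, (1 - m) a_1) is
    admissible.  Its cost is r^2, whence c0 eps0^2 + c1 eps1^2 <= r^2.

    Existence of minimizers ([unobserved_orthocomplemented]).  The energy need
    not be coercive on unobserved pairs when tau is 0 or 1.  In infinite
    dimension, however, the well-posedness assumption makes P0 coercive on
    ker L0 /\ ker L1 (take h_0 = h_1) and P1 coercive on ker L1 (take h_0 = 0),
    and completeness gives orthogonal projections onto these two kernels; in
    finite dimension projections always exist.  Together the two projections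
    give one, for the energy form, onto a subspace of finite codimension in the
    space of unobserved pairs.  Orthogonal projections survive an extension by
    finitely many dimensions ([orthocomplemented_ker]), even for degenerate
    forms. *)

(** * Positive semidefinite forms and orthogonal projections *)

Section BilinearForms.
Context (R : realType) (V : lmodType R).
Implicit Types (B : V -> V -> R) (K : set V) (u v w x : V).

Definition symmetric_bilinear B : Prop :=
  (forall u v, B u v = B v u) /\ (forall w, scalar (B^~ w)).

Definition positive_semidefinite B : Prop := forall u, 0 <= B u u.

Definition linear_subspace K : Prop :=
  K 0 /\ forall a u v, K u -> K v -> K (a *: u + v).

Lemma subspaceD K u v : linear_subspace K -> K u -> K v -> K (u + v).
Proof. by move=> [_ KP] Ku Kv; rewrite -[u]scale1r; exact: KP. Qed.

Lemma subspaceZ K a u : linear_subspace K -> K u -> K (a *: u).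
Proof. by move=> [K0 KP] Ku; rewrite -[_ *: _]addr0; exact: KP. Qed.

Lemma subspaceN K u : linear_subspace K -> K u -> K (- u).
Proof. by rewrite -scaleN1r => *; exact: subspaceZ. Qed.

Lemma subspaceB K u v : linear_subspace K -> K u -> K v -> K (u - v).
Proof. by move=> sK Ku Kv; apply: subspaceD => //; exact: subspaceN. Qed.

Lemma subspaceI K K' : linear_subspace K -> linear_subspace K' ->
  linear_subspace (K `&` K').
Proof.
move=> [K0 KP] [K0' KP']; split=> // a u v [Ku Ku'] [Kv Kv'].
by split; [exact: KP|exact: KP'].
Qed.

Lemma scalar0 (l : V -> R) : scalar l -> l 0 = 0.
Proof.
by move=> ll; have := ll (-1) 0 0; rewrite scaler0 addr0 mulN1r addNr.
Qed.

Section Form.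
Variable B : V -> V -> R.
Hypothesis Bsb : symmetric_bilinear B.

Lemma bformC u v : B u v = B v u. Proof. exact: Bsb.1. Qed.

Lemma bformDl u v w : B (u + v) w = B u w + B v w.
Proof. by rewrite -[u in LHS]scale1r Bsb.2 mul1r. Qed.

Lemma bform0l w : B 0 w = 0.
Proof. by apply: (addrI (B 0 w)); rewrite -bformDl !addr0. Qed.

Lemma bformZl a u w : B (a *: u) w = a * B u w.
Proof. by rewrite -[_ *: _]addr0 Bsb.2 bform0l addr0. Qed.

Lemma bformBl u v w : B (u - v) w = B u w - B v w.
Proof. by rewrite bformDl -scaleN1r bformZl mulN1r. Qed.

Lemma bformDr u v w : B w (u + v) = B w u + B w v.
Proof. by rewrite bformC bformDl !(bformC w). Qed.

Lemma bformZr a u w : B w (a *: u) = a * B w u.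
Proof. by rewrite bformC bformZl (bformC w). Qed.

Lemma quadD a b u v : B (a *: u + b *: v) (a *: u + b *: v) =
  a ^+ 2 * B u u + 2 * a * b * B u v + b ^+ 2 * B v v.
Proof. rewrite bformDl !bformDr !bformZl !bformZr (bformC v u); ring. Qed.

(** First-order optimality: moving from [x] by a small multiple of [- b] times
    [t], with [b = B x t], would decrease the form if [b] were nonzero. *)
Lemma minimal_orthogonal K x : linear_subspace K -> positive_semidefinite B ->
  (forall t, K t -> B x x <= B (x + t) (x + t)) -> forall t, K t -> B x t = 0.
Proof.
move=> sK B0 xmin t Kt; set b := B x t.
have q0 := B0 t; set q := B t t in q0.
(* Adding 1 to q keeps the step defined when t is isotropic. *)
have /xmin : K ((- (b / (q + 1))) *: t) by exact: subspaceZ.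
rewrite -[in x + _](scale1r x) quadD expr1n mul1r -/b -/q => H.
have q1 : q + 1 != 0 by rewrite gt_eqF// ltr_wpDl.
set z := b / (q + 1) in H.
have bz : b = z * (q + 1) by rewrite /z divfK.
rewrite bz in H *.
have : z ^+ 2 * (q + 2) <= 0 by nra.
rewrite pmulr_lle0 ?ltr_wpDl// => z2.
have /eqP -> : z == 0 by rewrite -sqrf_eq0 eq_le z2 sqr_ge0.
by rewrite mul0r.
Qed.

(** An isotropic vector is a global minimizer of a semidefinite form. *)
Lemma isotropic_orthogonal x v : positive_semidefinite B ->
  B v v = 0 -> B x v = 0.
Proof.
move=> B0 v0; rewrite bformC.
apply: (@minimal_orthogonal setT) => // t _.
by rewrite v0; exact: B0.
Qed.

(** The form may be degenerate, so the projection [s] of [b] need not be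
    unique. *)
Definition orthocomplemented K : Prop :=
  forall b, exists2 s, K s & forall t, K t -> B (b - s) t = 0.

(** One Gram-Schmidt step: outside the kernel of [l] in [K] there is at most one
    more direction [v]; it is replaced by its residual [w], which is orthogonal
    to the kernel, and the projections on the kernel and on [w] add up. *)
Lemma orthocomplemented_ker1 K (l : V -> R) : positive_semidefinite B ->
  linear_subspace K -> scalar l ->
  orthocomplemented (K `&` [set x | l x = 0]) ->
  orthocomplemented K.
Proof.
move=> B0 sK ll oK.
have lB a u v : l (u - a *: v) = l u - a * l v.
  by rewrite addrC -scaleNr ll mulNr addrC.
have [[v [Kv lv]]|Kl] := pselect (exists v, K v /\ l v != 0); last first.
  have Kle x : K x -> l x = 0.
    by move=> Kx; apply/eqP/negPn/negP => lx; apply: Kl; exists x.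
  move=> b; have [s [Ks _] bs] := oK b; exists s => // t Kt.
  by apply: bs; split=> //; exact: Kle.
have [sv [Ksv lsv] vsv] := oK v.
set w := v - sv in vsv.
have Kw : K w by exact: subspaceB.
have lw : l w = l v by rewrite /w -[sv]scale1r lB lsv mulr0 subr0.
move=> b; have [sb [Ksb _] bsb] := oK b.
pose c := B (b - sb) w / B w w.
exists (sb + c *: w).
  by apply: subspaceD => //; exact: subspaceZ.
(* If w is isotropic the coefficient c is 0, because 0^-1 = 0, and w is
   orthogonal to everything. *)
have bw : B (b - (sb + c *: w)) w = 0.
  rewrite opprD addrA bformBl bformZl /c.
  have [w0|w0] := eqVneq (B w w) 0; last by rewrite divfK// subrr.
  by rewrite w0 mulr0 subr0 isotropic_orthogonal.
move=> t Kt; set a := l t / l v.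
have Kta : (K `&` [set x | l x = 0]) (t - a *: w).
  split; first by apply: subspaceB => //; exact: subspaceZ.
  by rewrite /= lB lw divfK// subrr.
rewrite -(subrK (a *: w) t) bformDr bformZr bw mulr0 addr0.
by rewrite opprD addrA bformBl bformZl bsb// vsv// mulr0 subrr.
Qed.

Lemma orthocomplemented_ker K m (l : 'I_m -> V -> R) :
  positive_semidefinite B -> linear_subspace K -> (forall i, scalar (l i)) ->
  orthocomplemented (K `&` [set x | forall i, l i x = 0]) ->
  orthocomplemented K.
Proof.
move=> B0; elim: m l K => [|m IH] l K sK ll.
  rewrite (_ : [set x | _] = setT) ?setIT//.
  by apply/seteqP; split => // x _ [].
move=> oK; apply: (@orthocomplemented_ker1 _ (l ord0)) => //.
apply: (IH (fun i => l (lift ord0 i))) => //.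
  split; first by split; [exact: sK.1|exact: scalar0].
  move=> a u v [Ku lu] [Kv lv]; split; first exact: sK.2.
  by rewrite /= ll lu lv mulr0 addr0.
rewrite -setIA (_ : _ `&` [set x | forall i, l (lift ord0 i) x = 0] =
  [set x | forall i, l i x = 0])//.
apply/seteqP; split => [x [x0 xs] i|x xs]; last by split => // i; exact: xs.
by have [j ->|->] := unliftP ord0 i.
Qed.

End Form.

Lemma symmetric_bilinear_comb a b A B :
  symmetric_bilinear A -> symmetric_bilinear B ->
  symmetric_bilinear (fun u v => a * A u v + b * B u v).
Proof.
move=> [Asym AP] [Bsym BP]; split=> [u v|w c u v]; first by rewrite Asym Bsym.
rewrite AP BP; ring.
Qed.

End BilinearForms.

(** * Yuan's lemma on the maximum of two quadratic forms *)

Section Yuan.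
Context (R : realType) (V : lmodType R).
Variables (A B : V -> V -> R) (N : set V).
Hypotheses (Asb : symmetric_bilinear A) (Bsb : symmetric_bilinear B).
Hypothesis sN : linear_subspace N.
Hypothesis max_ge0 : forall x, N x -> 0 <= Num.max (A x x) (B x x).

(** Suppose the combination C with weight [m] were negative at both [h] and
    [k].  After replacing [k] by [- k] if necessary, C is negative on the whole
    segment from [h] to [k].  Since [A - B] changes sign along that segment,
    there is a point where A = B = C < 0, so that the maximum is negative. *)
Lemma negative_combinations_incompatible h k m : N h -> N k ->
  B h h < 0 <= A h h -> A k k < 0 <= B k k -> 0 <= m <= 1 ->
  m * A h h + (1 - m) * B h h < 0 -> 0 <= m * A k k + (1 - m) * B k k.
Proof.
move=> Nh Nk0 hAB; wlog C0 : k Nk0 / m * A h k + (1 - m) * B h k <= 0.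
  move=> W; have [C0|C0] := leP (m * A h k + (1 - m) * B h k) 0.
    exact: W.
  move=> kAB m01 Ch; have kN := scaleN1r k.
  have kk X : symmetric_bilinear X -> X (- k) (- k) = X k k.
    by move=> Xsb; rewrite -kN bformZl// bformZr// !mulN1r opprK.
  have hk X : symmetric_bilinear X -> X h (- k) = - X h k.
    by move=> Xsb; rewrite -kN bformZr// mulN1r.
  have := W _ (subspaceN sN Nk0); rewrite !kk// !hk//; apply=> //.
  by rewrite !mulrN -opprD oppr_le0 ltW.
move=> kAB m01 Ch; rewrite leNgt; apply/negP => Ck.
(* f is the restriction of A - B to the segment, as a polynomial. *)
pose x (s : R) := (1 - s) *: h + s *: k.
pose f (s : R) := (1 - s) ^+ 2 * (A h h - B h h) +
  2 * (1 - s) * s * (A h k - B h k) + s ^+ 2 * (A k k - B k k).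
have fE s : A (x s) (x s) - B (x s) (x s) = f s.
  by rewrite /x !quadD// /f; ring.
have fc : continuous f.
  have c1 (s : R) : (1 - t) @[t --> s] --> 1 - s.
    by apply: cvgB; [exact: cvg_cst|exact: cvg_id].
  move=> s; apply: cvgD; first apply: cvgD.
  - by apply: cvgMl; apply: cvgM; exact: c1.
  - apply: cvgMl; apply: cvgM; last exact: cvg_id.
    by apply: cvgMr; exact: c1.
  - by apply: cvgMl; apply: cvgM; exact: cvg_id.
have f0 : f 0 = A h h - B h h by rewrite /f; ring.
have f1 : f 1 = A k k - B k k by rewrite /f; ring.
have [||s] := @IVT _ f 0 1 0 ler01.
- exact: continuous_subspaceT.
- rewrite f0 f1 ge_min le_max.
  by apply/andP; split; apply/orP; [right|left]; lra.
rewrite in_itv/= => /andP[s0 s1] fs0.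
have Nx : N (x s) by apply: subspaceD => //; exact: subspaceZ.
have AB : A (x s) (x s) = B (x s) (x s) by have := fE s; lra.
have := max_ge0 Nx; rewrite -AB maxxx => Ax.
have : m * A (x s) (x s) + (1 - m) * B (x s) (x s) < 0.
  rewrite /x !quadD//.
  rewrite [X in X < 0](_ : _ = (1 - s) ^+ 2 * (m * A h h + (1 - m) * B h h) +
    2 * ((1 - s) * s) * (m * A h k + (1 - m) * B h k) +
    s ^+ 2 * (m * A k k + (1 - m) * B k k)); last by ring.
  have ss : 0 <= (1 - s) * s by rewrite mulr_ge0// subr_ge0.
  have : (1 - s) ^+ 2 * (m * A h h + (1 - m) * B h h) +
    s ^+ 2 * (m * A k k + (1 - m) * B k k) < 0.
    have [->|sn0] := eqVneq s 0.
      by rewrite expr0n mul0r addr0 subr0 expr1n mul1r.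
    have sp : 0 < s ^+ 2 by rewrite exprn_even_gt0.
    have := sqr_ge0 (1 - s); nra.
  nra.
by rewrite -AB -mulrDl subrKC mul1r ltNge Ax.
Qed.

(** Yuan's lemma.  Each [h] with [B h h < 0 <= A h h] bounds the weight from
    below, by the root of the combination at [h], and each [k] with
    [A k k < 0 <= B k k] bounds it from above; by the previous lemma every
    lower bound is at most every upper bound, and the supremum of the lower
    bounds is a valid weight. *)
Lemma nonneg_max_combination : exists2 m, 0 <= m <= 1 &
  forall x, N x -> 0 <= m * A x x + (1 - m) * B x x.
Proof.
pose E := [set m | m = 0 \/ 0 <= m <= 1 /\ exists h,
  [/\ N h, B h h < 0 <= A h h & m * A h h + (1 - m) * B h h <= 0]].
have E0 : E 0 by left.
have E1 : ubound E 1 by move=> m [->|[/andP[]]].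
have supE : has_sup E by split; [exists 0|exists 1].
have le_sup m : E m -> m <= sup E by exact: sup_upper_bound.
exists (sup E).
  by rewrite le_sup//= ge_sup//; exists 0.
set s := sup E => x Nx.
have s0 : 0 <= s by exact: le_sup.
have s1 : s <= 1 by apply: ge_sup => //; exists 0.
have := max_ge0 Nx; rewrite le_max => ABx.
have [A0|A0] := leP 0 (A x x); have [B0|B0] := leP 0 (B x x).
- by rewrite addr_ge0// mulr_ge0// subr_ge0.
- have AB : 0 < A x x - B x x by lra.
  have rE : - B x x / (A x x - B x x) * (A x x - B x x) = - B x x.
    by rewrite divfK ?gt_eqF.
  set r := - B x x / (A x x - B x x) in rE.
  suff /le_sup : E r by rewrite -/s; nra.
  right; split; first by apply/andP; split; nra.
  by exists x; split=> //; [rewrite B0|nra].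
- have AB : 0 < B x x - A x x by lra.
  have rE : B x x / (B x x - A x x) * (B x x - A x x) = B x x.
    by rewrite divfK ?gt_eqF.
  set r := B x x / (B x x - A x x) in rE.
  suff : s <= r by nra.
  apply: ge_sup; first by exists 0.
  move=> m [->|[m01 [h [Nh hAB Ch]]]]; first by nra.
  rewrite leNgt; apply/negP => rm.
  have r0 : 0 <= r by nra.
  (* Strictly between r and m, both combinations are negative. *)
  have : 0 <= (m + r) / 2 * A x x + (1 - (m + r) / 2) * B x x.
    apply: (@negative_combinations_incompatible h x) => //.
    + by rewrite A0.
    + lra.
    + nra.
  nra.
- by move: ABx; rewrite !leNgt A0 B0.
Qed.

End Yuan.

(** * Orthogonal projections in Hilbert spaces *)

Section HilbertForms.
Context (R : realType).

Definition pulled_inner (V : lmodType R) (H : hilbertType R) (P : V -> H) u v :=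
  inner (P u) (P v).

Lemma pulled_inner_sb (V : lmodType R) (H : hilbertType R) (P : V -> H) :
  linear P -> symmetric_bilinear (pulled_inner P).
Proof.
move=> Pl; split=> [u v|w a u v]; first exact: innerC.
by rewrite /pulled_inner Pl innerP.
Qed.

Lemma pulled_inner_norm (V : lmodType R) (H : hilbertType R)
  (P : V -> H) u : pulled_inner P u u = `|P u| ^+ 2.
Proof. exact: inner_norm. Qed.

Lemma pulled_inner_ge0 (V : lmodType R) (H : hilbertType R) (P : V -> H) :
  positive_semidefinite (pulled_inner P).
Proof. by move=> u; rewrite pulled_inner_norm sqr_ge0. Qed.

(** The projection theorem: by the parallelogram identity the images under [P]
    of a minimizing sequence are Cauchy, by coercivity so is the sequence, and
    its limit minimizes the distance to [b] measured through [P]. *)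
Lemma coercive_orthocomplemented (F H : hilbertType R) (P : {linear F -> H})
    (K : set F) (C : R) :
  continuous P -> closed K -> linear_subspace K -> 0 < C ->
  (forall k, K k -> C * `|k| <= `|P k|) ->
  orthocomplemented (pulled_inner P) K.
Proof.
move=> Pc cK sK C0 PC b.
pose D := [set `|P (b - k)| ^+ 2 | k in K].
have infD : has_inf D.
  split; last by exists 0 => _ [k _ <-]; exact: sqr_ge0.
  exists (`|P (b - 0)| ^+ 2), 0 => //; exact: sK.1.
have le_inf k : K k -> inf D <= `|P (b - k)| ^+ 2.
  by move=> Kk; apply: ge_inf; [exact: infD.2|exists k].
have /choice[k kP] (n : nat) :
    exists k, K k /\ `|P (b - k)| ^+ 2 < inf D + harmonic n.
  have [_ [k Kk <-] kn] := inf_adherent (@harmonic_gt0 R n) infD.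
  by exists k.
have Kk n : K (k n) := (kP n).1.
have dist n m : C ^+ 2 * `|k n - k m| ^+ 2 <= 2 * (harmonic n + harmonic m).
  have mid : K (2^-1 *: k n + 2^-1 *: k m).
    by apply: subspaceD => //; exact: subspaceZ.
  have Pnm : C ^+ 2 * `|k n - k m| ^+ 2 <= `|P (k n - k m)| ^+ 2.
    rewrite -exprMn; apply: lerXn2r; rewrite ?nnegrE ?mulr_ge0 ?(ltW C0)//.
    by apply: PC; apply: subspaceB.
  have := le_inf _ mid; have := (kP n).2; have := (kP m).2.
  rewrite -!pulled_inner_norm in Pnm *.
  set u := b - k n; set v := b - k m.
  have -> : b - (2^-1 *: k n + 2^-1 *: k m) = 2^-1 *: u + 2^-1 *: v.
    have half : 2^-1 + 2^-1 = 1 :> R by lra.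
    by rewrite /u /v !scalerBr addrACA -opprD -scalerDl half scale1r.
  have E : k n - k m = (- 1) *: u + 1 *: v.
    by rewrite /u /v scale1r scaleN1r opprB addrA subrK.
  move: Pnm; rewrite E !(quadD (pulled_inner_sb (linearP P))); lra.
have kcauchy : cauchy (k n @[n --> \oo]).
  apply/cauchy_ballP => e e0.
  near \oo => N.
  have Ne : harmonic N < C ^+ 2 * e ^+ 2 / 4 :> R.
    near: N; apply: (@cvgr_lt _ _ _ _ _ 0); [exact: cvg_harmonic|].
    by rewrite divr_gt0// mulr_gt0// exprn_gt0.
  exists (k @` [set n | (N <= n)%N], k @` [set n | (N <= n)%N]).
    by split; exists N => // n Nn; exists n.
  move=> [_ _] /= [[n Nn <-] [m Nm <-]].
  have hle p : (N <= p)%N -> harmonic p <= harmonic N :> R.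
    by move=> Np; rewrite /harmonic /= lef_pV2 ?posrE// ler_nat.
  rewrite -ball_normE /= -(@ltr_pXn2r _ 2%N) ?nnegrE// ?ltW//.
  have := dist n m; have := hle _ Nn; have := hle _ Nm.
  have C2 : 0 < C ^+ 2 by rewrite exprn_gt0.
  rewrite -(ltr_pM2l C2); lra.
have /cauchy_cvg/cvg_ex[s ks] := kcauchy.
have Ks : K s by apply: (closed_cvg _ cK _ _ ks); near=> n.
exists s => //.
have sb := pulled_inner_sb (linearP P).
apply: (minimal_orthogonal sb sK (pulled_inner_ge0 P)) => t Kt.
rewrite !pulled_inner_norm.
have /le_inf : K (s - t) by exact: subspaceB.
rewrite opprB addrCA addrC; apply: le_trans.
have lim1 : `|P (b - k n)| ^+ 2 @[n --> \oo] --> `|P (b - s)| ^+ 2.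
  rewrite !expr2.
  have lim : `|P (b - k n)| @[n --> \oo] --> `|P (b - s)|.
    apply: cvg_norm; apply: (continuous_cvg _ (Pc _)).
    by apply: cvgB ks; exact: cvg_cst.
  exact: cvgM.
have lim2 : inf D + harmonic n @[n --> \oo] --> inf D + 0.
  by apply: cvgD; [exact: cvg_cst|exact: cvg_harmonic].
rewrite -[leRHS]addr0; apply: (ler_cvg_to lim1 lim2).
by near=> n; rewrite ltW// (kP n).2.
Unshelve. all: by end_near. Qed.

(** A spanning family only gives a surjection from row vectors, whose
    coordinates need not descend to [V]; so the form and the subspace are pulled
    back to row vectors, where the common kernel of the coordinates is 0. *)
Lemma finite_dimensional_orthocomplemented (V : lmodType R) (B : V -> V -> R)
    (K : set V) :
  symmetric_bilinear B -> positive_semidefinite B -> linear_subspace K ->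
  finite_dimensional V -> orthocomplemented B K.
Proof.
move=> Bsb B0 sK [n [e eP]].
pose E (c : 'rV[R]_n) := \sum_(i < n) c 0 i *: e i.
have EP a c d : E (a *: c + d) = a *: E c + E d.
  rewrite /E scaler_sumr -big_split/=; apply: eq_bigr => i _.
  by rewrite !mxE scalerDl scalerA.
have Esurj x : exists c, x = E c.
  have [c ->] := eP x; exists (\row_i c i).
  by apply: eq_bigr => i _; rewrite mxE.
have E0 : E 0 = 0 by apply: big1 => i _; rewrite mxE scale0r.
have EB c d : E (c - d) = E c - E d.
  by rewrite -[- d]scaleN1r [in LHS]addrC EP scaleN1r addrC.
have oK : orthocomplemented (fun c d => B (E c) (E d)) (E @^-1` K).
  have sb : @symmetric_bilinear R 'rV[R]_n (fun c d => B (E c) (E d)).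
    by split=> [c d|w a c d]; rewrite ?EP ?Bsb.2//; exact: Bsb.1.
  apply: (@orthocomplemented_ker R 'rV[R]_n _ sb _ n (fun i c => c 0 i)).
  - by move=> c; exact: B0.
  - split; first by rewrite /= E0; exact: sK.1.
    by move=> a c d Kc Kd; rewrite /= EP; exact: sK.2.
  - by move=> i a c d; rewrite !mxE.
  - move=> b; exists 0.
      by split; [rewrite /= E0; exact: sK.1|move=> i; rewrite mxE].
    move=> t [_ t0]; rewrite (_ : t = 0) ?E0 ?(bformC Bsb _ 0) ?bform0l//.
    by apply/rowP => i; rewrite mxE t0.
move=> b; have [c ->] := Esurj b; have [s Ks st] := oK c.
exists (E s) => // t; have [d ->] := Esurj t => Kd.
by rewrite -EB; exact: st.
Qed.

End HilbertForms.

(** * The regularized recovery problem *)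

Section Recovery.
Context (R : realType) (F H0 H1 Z : hilbertType R) (m0 m1 : nat).
Context (P0 : {linear F -> H0}) (P1 : {linear F -> H1}).
Context (L0 : {linear F -> 'cV[R]_m0}) (L1 : {linear F -> 'cV[R]_m1}).
Context (Q : {linear F -> Z}).
Implicit Types (f g h t : F * F) (tau : R).

Definition fidelity_map f : H0 := P0 f.1.
Definition gap_map f : H1 := P1 (f.1 - f.2).
Definition target_map f : Z := Q f.1.

Lemma fidelity_map_linear : linear fidelity_map.
Proof. by move=> a u v; rewrite /fidelity_map linearP. Qed.

Lemma gap_map_linear : linear gap_map.
Proof.
move=> a u v; rewrite /gap_map -linearP /=; congr (P1 _).
by rewrite scalerBr opprD addrACA.
Qed.

Lemma target_map_linear : linear target_map.
Proof. by move=> a u v; rewrite /target_map linearP. Qed.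

Definition energy tau f g : R :=
  (1 - tau) * pulled_inner fidelity_map f g + tau * pulled_inner gap_map f g.

Lemma energy_sb tau : symmetric_bilinear (energy tau).
Proof.
apply: symmetric_bilinear_comb; apply: pulled_inner_sb.
  exact: fidelity_map_linear.
exact: gap_map_linear.
Qed.

Lemma energyE tau f : energy tau f f =
  (1 - tau) * `|P0 f.1| ^+ 2 + tau * `|P1 (f.1 - f.2)| ^+ 2.
Proof. by rewrite /energy !pulled_inner_norm. Qed.

Lemma energy_ge0 tau : 0 <= tau <= 1 -> positive_semidefinite (energy tau).
Proof.
move=> /andP[t0 t1] f.
by rewrite energyE addr_ge0// mulr_ge0// ?subr_ge0// sqr_ge0.
Qed.

Definition unobserved : set (F * F) := [set h | L0 h.1 = 0 /\ L1 h.2 = 0].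

Lemma unobserved_subspace : linear_subspace unobserved.
Proof.
split; first by rewrite /unobserved /= !linear0.
move=> a u v [u0 u1] [v0 v1].
by rewrite /unobserved /= !linearP u0 u1 v0 v1 !scaler0 !addr0.
Qed.

Lemma kernel_subspace m (L : {linear F -> 'cV[R]_m}) :
  linear_subspace (L @^-1` [set 0]).
Proof.
split=> [|a u v /= u0 v0]; first by rewrite /= linear0.
by rewrite linearP u0 v0 scaler0 addr0.
Qed.

Lemma kernel_closed m (L : {linear F -> 'cV[R]_m}) :
  continuous L -> closed (L @^-1` [set 0]).
Proof.
move=> Lc; apply: preimage_closed; first by move=> x _; exact: Lc.
apply: accessible_closed_set1; apply: hausdorff_accessible.
exact: norm_hausdorff.
Qed.

(** ** Existence of regularizers *)

Section Existence.
Context (eps0 eps1 : R).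
Hypotheses (P0c : continuous P0) (P1c : continuous P1).
Hypotheses (L0c : continuous L0) (L1c : continuous L1).
Hypotheses (eps0_gt0 : 0 < eps0) (eps1_gt0 : 0 < eps1).
Hypothesis well_posed : standing_assumption P0 P1 L0 L1 eps0 eps1.

(** In infinite dimension, well-posedness at a diagonal pair [h; h] makes [P0]
    coercive on this subspace. *)
Lemma fidelity_orthocomplemented :
  orthocomplemented (pulled_inner P0) (L0 @^-1` [set 0] `&` L1 @^-1` [set 0]).
Proof.
have sK := subspaceI (kernel_subspace L0) (kernel_subspace L1).
have [fd|/(well_posed.2)[d d0 dP]] := pselect (finite_dimensional F).
  apply: finite_dimensional_orthocomplemented => //.
    exact/pulled_inner_sb/linearP.
  exact: pulled_inner_ge0.
apply: (@coercive_orthocomplemented _ _ _ _ _ (eps0 * d)) => //.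
- by apply: closedI; exact: kernel_closed.
- exact: mulr_gt0.
- move=> k [k0 k1]; have := dP _ _ k0 k1.
  rewrite subrr linear0 normr0 mulr0.
  rewrite max_l ?mulr_ge0 ?invr_ge0 ?(ltW eps0_gt0)//.
  rewrite ler_pdivlMl// -mulrA; apply: le_trans.
  rewrite !ler_pM2l// -[leLHS]ger0_norm// -sqrtr_sqr ler_wsqrtr//.
  by rewrite lerDl sqr_ge0.
Qed.

(** In infinite dimension, well-posedness at a pair [0; h] makes [P1] coercive
    on this subspace. *)
Lemma gap_orthocomplemented :
  orthocomplemented (pulled_inner P1) (L1 @^-1` [set 0]).
Proof.
have sK := kernel_subspace L1.
have [fd|/(well_posed.2)[d d0 dP]] := pselect (finite_dimensional F).
  apply: finite_dimensional_orthocomplemented => //.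
    exact/pulled_inner_sb/linearP.
  exact: pulled_inner_ge0.
apply: (@coercive_orthocomplemented _ _ _ _ _ (eps1 * d)) => //.
- exact: kernel_closed.
- exact: mulr_gt0.
- move=> k k0; have := dP _ _ (linear0 L0) k0.
  rewrite sub0r linear0 linearN !normr0 mulr0 normrN.
  rewrite max_r ?mulr_ge0 ?invr_ge0 ?(ltW eps1_gt0)//.
  by rewrite ler_pdivlMl// -mulrA expr0n add0r sqrtr_sqr normr_id.
Qed.

(** The pairs [t] with [t.1] in ker L0 /\ ker L1 and [t.2] in ker L1 are cut out
    of the unobserved ones by the [m1] functionals [L1 t.1 = 0].  In the
    coordinates [t.1] and [t.1 - t.2] they form a product on which the energy
    splits, so the two projections can be taken separately, whatever the
    value of [tau] between 0 and 1. *)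
Lemma unobserved_orthocomplemented tau : 0 <= tau <= 1 ->
  orthocomplemented (energy tau) unobserved.
Proof.
move=> tau01.
apply: (@orthocomplemented_ker R _ _ (energy_sb tau) _ m1
  (fun i h => L1 h.1 i 0)) => //.
- exact: energy_ge0.
- exact: unobserved_subspace.
- by move=> i a u v; rewrite /= linearP !mxE.
- move=> b; have [s [s0 s1] bs] := fidelity_orthocomplemented b.1.
  have [d d1 bd] := gap_orthocomplemented (b.1 - b.2).
  exists (s, s - d) => /=.
    split; first by split=> //=; rewrite linearB s1 d1 subr0.
    by move=> i; rewrite /= s1 mxE.
  move=> t [[t0 t2] t1].
  have t10 : L1 t.1 = 0 by apply/colP => i; rewrite t1 mxE.
  rewrite /energy /pulled_inner /fidelity_map /gap_map /=.
  rewrite [X in P1 X](_ : _ = b.1 - b.2 - d); last first.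
    by rewrite opprB !addrA subrK addrAC.
  have := bs t.1 (conj t0 t10); rewrite /pulled_inner => ->.
  have := bd (t.1 - t.2); rewrite /pulled_inner => ->.
    by rewrite !mulr0 addr0.
  by rewrite /= linearB t10 t2 subr0.
Qed.

Lemma orthogonal_interpolant tau f : 0 <= tau <= 1 ->
  exists2 g, unobserved (g - f) &
    forall t, unobserved t -> energy tau g t = 0.
Proof.
move=> tau01; have [s Ns fs] := unobserved_orthocomplemented tau01 f.
exists (f - s) => //; rewrite addrAC subrr add0r.
exact: (subspaceN unobserved_subspace).
Qed.

End Existence.

Lemma feasibleP f g :
  [set x : F * F | L0 x.1 = usubmx (observation L0 L1 f) /\
                   L1 x.2 = dsubmx (observation L0 L1 f)] g <->
  unobserved (g - f).
Proof.
rewrite /observation /unobserved /= col_mxKu col_mxKd !linearB.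
split=> -[e0 e1]; first by rewrite e0 e1 !subrr.
by split; apply/eqP; rewrite -subr_eq0 ?e0 ?e1.
Qed.

(** ** Regularizers and orthogonality *)

Section Orthogonal.
Context (tau : R) (f g : F * F).
Hypotheses (tau01 : 0 <= tau <= 1) (fg : unobserved (g - f)).
Hypothesis g_orth : forall t, unobserved t -> energy tau g t = 0.

Lemma energy_pythagoras t : unobserved t ->
  energy tau (g + t) (g + t) = energy tau g g + energy tau t t.
Proof.
move=> Nt; have := quadD (energy_sb tau) 1 1 g t.
by rewrite !scale1r expr1n (g_orth Nt) !mulr0 addr0 !mul1r.
Qed.

Lemma orthogonal_regularizer :
  regularizers P0 P1 L0 L1 tau (observation L0 L1 f) g.
Proof.
split; first exact/feasibleP.
move=> y /feasibleP fy; rewrite -!energyE.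
have Nyg : unobserved (y - g).
  rewrite (_ : y - g = (y - f) - (g - f)); last by rewrite opprB addrA subrK.
  exact: (subspaceB unobserved_subspace).
by rewrite -(subrKC g y) energy_pythagoras// lerDl energy_ge0.
Qed.

(** Regularizers need not be unique, but the orthogonal interpolant [g] differs
    from each of them only by a pair of zero energy, by Pythagoras. *)
Lemma regularizer_energy g' :
  regularizers P0 P1 L0 L1 tau (observation L0 L1 f) g' ->
  unobserved (g - g') /\ energy tau (g - g') (g - g') = 0.
Proof.
move=> [/feasibleP fg' /(_ g (iffRL (feasibleP f g) fg))].
rewrite -!energyE => le_g'g.
have Ngg' : unobserved (g - g').
  rewrite (_ : g - g' = (g - f) - (g' - f)); last by rewrite opprB addrA subrK.
  exact: (subspaceB unobserved_subspace).
split=> //; apply/eqP; rewrite eq_le energy_ge0// andbT.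
have Ng'g := subspaceN unobserved_subspace Ngg'.
have := energy_pythagoras Ng'g; rewrite opprB subrKC => g'E.
have -> : energy tau (g - g') (g - g') = energy tau (g' - g) (g' - g).
  have := quadD (energy_sb tau) (-1) 0 (g - g') 0.
  rewrite !scaler0 !addr0 scaleN1r opprB => ->.
  by rewrite sqrrN !expr1n mul1r mulr0 mul0r expr0n mul0r !addr0.
by rewrite g'E gerDl in le_g'g.
Qed.

End Orthogonal.

(** ** Worst-case errors *)

Section Optimality.
Context (eps0 eps1 c0 c1 : R).
Hypotheses (eps0_gt0 : 0 < eps0) (eps1_gt0 : 0 < eps1).
Hypothesis c_optimal : optimal_coefficients P0 P1 L0 L1 Q eps0 eps1 (c0, c1).
Hypothesis c_gt0 : 0 < c0 + c1.
Let tau := c1 / (c0 + c1).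

Lemma tau_bounds : 0 <= tau <= 1.
Proof.
have [[c00 c10 _] _] := c_optimal.
by rewrite /tau divr_ge0 ?(ltW c_gt0)//= ler_pdivrMr// mul1r lerDr.
Qed.

Lemma energy_coefficients f : (c0 + c1) * energy tau f f =
  c0 * `|P0 f.1| ^+ 2 + c1 * `|P1 (f.1 - f.2)| ^+ 2.
Proof.
have tauE : (c0 + c1) * tau = c1 by rewrite mulrC divfK// gt_eqF.
by move: tau tauE => s sE; rewrite energyE mulrDr !mulrA mulrBr mulr1 sE addrK.
Qed.

Lemma target_le_energy h : unobserved h ->
  `|Q h.1| ^+ 2 <= (c0 + c1) * energy tau h h.
Proof.
have [[_ _ cP] _] := c_optimal => -[h0 h1].
by rewrite energy_coefficients; exact: cP.
Qed.

Lemma target_isotropic h : unobserved h -> energy tau h h = 0 -> Q h.1 = 0.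
Proof.
move=> Nh h0; have := target_le_energy Nh; rewrite h0 mulr0 => Qh.
by apply/eqP; rewrite -normr_eq0 -sqrf_eq0 eq_le Qh sqr_ge0.
Qed.

(** By Pythagoras the energy of [f - g] is at most that of [f], and the energy
    controls [Q] on unobserved pairs because (c0, c1) is admissible. *)
Lemma orthogonal_error f g : `|P0 f.1| <= eps0 -> `|P1 (f.1 - f.2)| <= eps1 ->
  unobserved (g - f) -> (forall t, unobserved t -> energy tau g t = 0) ->
  `|Q f.1 - Q g.1| ^+ 2 <= c0 * eps0 ^+ 2 + c1 * eps1 ^+ 2.
Proof.
move=> f0 f1 Ngf g_orth; have [[c00 c10 _] _] := c_optimal.
have Nfg : unobserved (f - g).
  by rewrite -opprB; exact: (subspaceN unobserved_subspace).
have := energy_pythagoras g_orth Nfg; rewrite subrKC => fE.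
have := target_le_energy Nfg; rewrite linearB => /le_trans; apply.
apply: (@le_trans _ _ ((c0 + c1) * energy tau f f)).
  by rewrite fE ler_pM2l// lerDr energy_ge0// tau_bounds.
rewrite energy_coefficients.
by apply: lerD; apply: ler_wpM2l => //; apply: lerXn2r;
  rewrite ?nnegrE ?(ltW eps0_gt0) ?(ltW eps1_gt0).
Qed.

(** A bound [r] on [Q] over the unobserved pairs of the model set yields,
    through Yuan's lemma, admissible coefficients of cost [r ^+ 2]. *)
Lemma strong_duality (r : R) : 0 <= r ->
  (forall h, unobserved h -> `|P0 h.1| <= eps0 -> `|P1 (h.1 - h.2)| <= eps1 ->
     `|Q h.1| <= r) ->
  c0 * eps0 ^+ 2 + c1 * eps1 ^+ 2 <= r ^+ 2.
Proof.
move=> r0 hr; have [[c00 c10 cP] cmin] := c_optimal.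
pose a0 := (r / eps0) ^+ 2; pose a1 := (r / eps1) ^+ 2.
pose A u v :=
  a0 * pulled_inner fidelity_map u v + (-1) * pulled_inner target_map u v.
pose B u v :=
  a1 * pulled_inner gap_map u v + (-1) * pulled_inner target_map u v.
have AE h : A h h = a0 * `|P0 h.1| ^+ 2 - `|Q h.1| ^+ 2.
  by rewrite /A !pulled_inner_norm mulN1r.
have BE h : B h h = a1 * `|P1 (h.1 - h.2)| ^+ 2 - `|Q h.1| ^+ 2.
  by rewrite /B !pulled_inner_norm mulN1r.
have sA : symmetric_bilinear A.
  by apply: symmetric_bilinear_comb; apply: pulled_inner_sb;
    [exact: fidelity_map_linear|exact: target_map_linear].
have sB : symmetric_bilinear B.
  by apply: symmetric_bilinear_comb; apply: pulled_inner_sb;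
    [exact: gap_map_linear|exact: target_map_linear].
have max_ge0 h : unobserved h -> 0 <= Num.max (A h h) (B h h).
  move=> Nh; rewrite AE BE le_max !subr_ge0 -!exprMn.
  (* M is the gauge of h for the model set; h / M lies on its boundary. *)
  pose M := Num.max (`|P0 h.1| / eps0) (`|P1 (h.1 - h.2)| / eps1).
  have M0 : 0 <= M by rewrite le_max divr_ge0// ltW.
  have PM : `|P0 h.1| <= M * eps0 by rewrite -ler_pdivrMr// le_max lexx.
  have PM' : `|P1 (h.1 - h.2)| <= M * eps1.
    by rewrite -ler_pdivrMr// le_max lexx orbT.
  have QM : `|Q h.1| <= r * M.
    (* When M = 0 scaling is impossible, but admissibility gives Q h.1 = 0. *)
    have [M00|Mn0] := eqVneq M 0.
      move: PM PM'; rewrite M00 !mul0r !normr_le0 mulr0 => /eqP p0 /eqP p1.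
      have := cP _ _ Nh.1 Nh.2; rewrite /= p0 p1 !normr0 !expr0n !mulr0 addr0.
      by move=> Q0; rewrite normr_le0 -normr_eq0 -sqrf_eq0 eq_le Q0 sqr_ge0.
    have Mp : 0 < M by rewrite lt_def Mn0.
    have := hr _ (subspaceZ M^-1 unobserved_subspace Nh).
    rewrite /= -scalerBr !linearZ /= !normrZ gtr0_norm ?invr_gt0//.
    by rewrite !ler_pdivrMl// (mulrC r); apply.
  have [e|e] := leP (`|P1 (h.1 - h.2)| / eps1) (`|P0 h.1| / eps0).
    apply/orP; left; apply: lerXn2r;
      rewrite ?nnegrE ?mulr_ge0 ?invr_ge0 ?(ltW eps0_gt0)//.
    by move: QM; rewrite /M (max_l e) mulrA mulrAC.
  apply/orP; right; apply: lerXn2r;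
      rewrite ?nnegrE ?mulr_ge0 ?invr_ge0 ?(ltW eps1_gt0)//.
  by move: QM; rewrite /M (max_r (ltW e)) mulrA mulrAC.
have [m /andP[m_ge0 m_le1] mP] :=
  nonneg_max_combination sA sB unobserved_subspace max_ge0.
have : c0 * eps0 ^+ 2 + c1 * eps1 ^+ 2 <=
  m * a0 * eps0 ^+ 2 + (1 - m) * a1 * eps1 ^+ 2.
  apply: (cmin (m * a0, (1 - m) * a1)); split=> /=.
  - by rewrite mulr_ge0// sqr_ge0.
  - by rewrite mulr_ge0// ?subr_ge0// sqr_ge0.
  - move=> f0 f1 l0 l1; have := mP (f0, f1) (conj l0 l1).
    by rewrite AE BE /=; lra.
have a0E : a0 * eps0 ^+ 2 = r ^+ 2 by rewrite -exprMn divfK// gt_eqF.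
have a1E : a1 * eps1 ^+ 2 = r ^+ 2 by rewrite -exprMn divfK// gt_eqF.
by rewrite -(mulrA m) -(mulrA (1 - m)) a0E a1E -mulrDl subrKC mul1r.
Qed.

End Optimality.

End Recovery.

Theorem theorem4 (R : realType) (F H0 H1 Z : hilbertType R) (m0 m1 : nat)
  (P0 : {linear F -> H0}) (P1 : {linear F -> H1})
  (L0 : {linear F -> 'cV[R]_m0}) (L1 : {linear F -> 'cV[R]_m1})
  (Q : {linear F -> Z})
  (P0_bounded : bounded_near P0 (nbhs 0))
  (P1_bounded : bounded_near P1 (nbhs 0))
  (L0_bounded : bounded_near L0 (nbhs 0))
  (L1_bounded : bounded_near L1 (nbhs 0))
  (Q_bounded : bounded_near Q (nbhs 0))
  (eps0 eps1 : R) (eps0_gt0 : 0 < eps0) (eps1_gt0 : 0 < eps1)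
  (well_posed : standing_assumption P0 P1 L0 L1 eps0 eps1)
  (c0 c1 : R)
  (c_optimal : optimal_coefficients P0 P1 L0 L1 Q eps0 eps1 (c0, c1))
  (c_gt0 : 0 < c0 + c1) :
  let tau := c1 / (c0 + c1) in
  [/\ forall f : F * F,
        regularizers P0 P1 L0 L1 tau (observation L0 L1 f) !=set0,
      forall (f g g' : F * F),
        regularizers P0 P1 L0 L1 tau (observation L0 L1 f) g ->
        regularizers P0 P1 L0 L1 tau (observation L0 L1 f) g' ->
        Q g.1 = Q g'.1
    & forall Delta : 'cV[R]_(m0 + m1) -> Z,
        (forall f g : F * F,
           regularizers P0 P1 L0 L1 tau (observation L0 L1 f) g ->
           Delta (observation L0 L1 f) = Q g.1) ->
        globally_optimal L0 L1 Q (hyperellipsoid P0 eps0)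
          (hyperellipsoid P1 eps1) Delta].
Proof.
move=> tau.
have /linear_bounded_continuous P0c := P0_bounded.
have /linear_bounded_continuous P1c := P1_bounded.
have /linear_bounded_continuous L0c := L0_bounded.
have /linear_bounded_continuous L1c := L1_bounded.
have t01 : 0 <= tau <= 1 := tau_bounds c_optimal c_gt0.
have interpolant f := orthogonal_interpolant P0c P1c L0c L1c
  eps0_gt0 eps1_gt0 well_posed f t01.
have uniq f g g' : unobserved L0 L1 (g - f) ->
    (forall t, unobserved L0 L1 t -> energy P0 P1 tau g t = 0) ->
    regularizers P0 P1 L0 L1 tau (observation L0 L1 f) g' -> Q g.1 = Q g'.1.
  move=> Ngf g_orth /(regularizer_energy t01 Ngf g_orth)[Ngg' gg'].
  have /eqP := target_isotropic c_optimal c_gt0 Ngg' gg'.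
  by rewrite linearB subr_eq0 => /eqP.
split.
- move=> f; have [g Ngf g_orth] := interpolant f.
  by exists g; exact: orthogonal_regularizer.
- move=> f g g' rg rg'; have [k Nkf k_orth] := interpolant f.
  by rewrite -(uniq _ _ _ Nkf k_orth rg) (uniq _ _ _ Nkf k_orth rg').
- move=> Delta DeltaE Delta'; apply: ge_ereal_sup => _ [f [f0 f1] <-].
  have [g Ngf g_orth] := interpolant f.
  rewrite (DeltaE _ _ (orthogonal_regularizer t01 Ngf g_orth)).
  have worst h : hyperellipsoid P0 eps0 h.1 ->
      hyperellipsoid P1 eps1 (h.1 - h.2) ->
      ((`|Q h.1 - Delta' (observation L0 L1 h)|)%:E <=
       gwce L0 L1 Q (hyperellipsoid P0 eps0) (hyperellipsoid P1 eps1) Delta')%E.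
    by move=> h0 h1; apply: ereal_sup_ubound; exists h.
  move: worst; case: (gwce _ _ _ _ _ Delta') => [r||] worst.
  + rewrite lee_fin.
    have r0 : 0 <= r by have := worst _ f0 f1; rewrite lee_fin; apply: le_trans.
    rewrite -(@ler_pXn2r _ 2%N) ?nnegrE//.
    apply: le_trans (orthogonal_error eps0_gt0 eps1_gt0 c_optimal c_gt0
      f0 f1 Ngf g_orth) _.
    apply: (strong_duality eps0_gt0 eps1_gt0 c_optimal r0) => h Nh h0 h1.
    have obs0 k : unobserved L0 L1 k -> observation L0 L1 k = 0.
      by move=> [k0 k1]; rewrite /observation k0 k1 col_mx0.
    (* Both h and - h produce the data 0, so Delta' 0 is within r of Q h.1
       and of its opposite. *)
    have := worst h h0 h1; have := worst (- h).
    rewrite (obs0 _ Nh) (obs0 _ (subspaceN (unobserved_subspace L0 L1) Nh)).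
    rewrite /hyperellipsoid /= -opprD !linearN !normrN !lee_fin => /(_ h0 h1).
    rewrite -opprD normrN => ge_r le_r.
    rewrite -(@ler_pM2l _ 2)// !mulr_natl -normrMn.
    have -> : Q h.1 *+ 2 = (Q h.1 + Delta' 0) + (Q h.1 - Delta' 0).
      by rewrite addrACA subrr addr0 mulr2n.
    by apply: (le_trans (ler_normD _ _)); rewrite mulr2n lerD.
  + by rewrite leey.
  + by have := worst _ f0 f1; rewrite leeNy_eq.
Qed.
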